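(* Let $h\in\mathcal H$ and $\varphi(\underline{x})=h(x_0,x_1)$ on $X=[0,1]^{\mathbb N_0}$. Let $a,b\in\mathrm{m}_h$ belong to the same connected component $C(a)$ of $\mathrm{m}_h$, and suppose that \[\lim_{\delta\to0^+}\left(\frac{h(z+\delta,z)-h(z,z)}{\delta}+\frac{h(z,z+\delta)-h(z,z)}{\delta}\right)=0\quad\text{for every }z\in C(a).\] Then $H_\varphi(a^\infty,b^\infty)+H_\varphi(b^\infty,a^\infty)=0$, i.e. $a^\infty\sim_\varphi b^\infty$.
   Context: $X=[0,1]^{\mathbb N_0}$ with metric $d_X(\underline{x},\underline{y})=\sum_{i\ge0}|x_i-y_i|/2^{i+1}$ and shift $\sigma(\underline{x})_i=x_{i+1}$. $\alpha_\varphi=\inf_\mu\int\varphi\,d\mu$ over $\sigma$-invariant Borel probability measures. $B(\underline{x},\underline{y},n;\varepsilon)=\{\underline{z}: d_X(\underline{x},\underline{z})<\varepsilon,\ d_X(\sigma^n\underline{z},\underline{y})<\varepsilon\}$; Peierls barrier $H_\varphi(\underline{x},\underline{y})=\lim_{\varepsilon\to0}\liminf_{n\to\infty}\inf\{\sum_{i=0}^{n-1}(\varphi(\sigma^i\underline{z})-\alpha_\varphi): \underline{z}\in B(\underline{x},\underline{y},n;\varepsilon)\}\in\mathbb R\cup\{+\infty\}$. $h^*=\min_x h(x,x)$, $\mathrm{m}_h=\{a: h(a,a)=h^*\}$, $a^\infty=aaa\ldots$. A finite sequence $(x_k,\dots,x_l)$ is minimal (for $h$) if $\sum_{i=k}^{l-1}h(x_i,x_{i+1})\le\sum_{i=k}^{l-1}h(y_i,y_{i+1})$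 for every $(y_k,\dots,y_l)$ in $[0,1]$ with the same endpoints. $\mathcal H$ is the set of Lipschitz $h:[0,1]^2\to\mathbb R$ such that (H3) if $\xi_1<\xi_2$, $\eta_1<\eta_2$ then $h(\xi_1,\eta_1)+h(\xi_2,\eta_2)<h(\xi_1,\eta_2)+h(\xi_2,\eta_1)$; and (H4) if $(x_{-1},x_0,x_1)\ne(x'_{-1},x_0,x'_1)$ are both minimal then $(x_{-1}-x'_{-1})(x_1-x'_1)<0$. *)

(* Defs.v *)
From HB Require Import structures.
From mathcomp Require Import all_boot all_order all_algebra.
From mathcomp Require Import all_classical all_reals all_analysis.
Set Implicit Arguments. Unset Strict Implicit. Unset Printing Implicit Defensive.
Import Order.TTheory GRing.Theory Num.Theory.
Import numFieldNormedType.Exports.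
Local Open Scope classical_set_scope.
Local Open Scope ring_scope.

Section Defs.
Variable R : realType.

Definition Xpred (x : nat -> R) : Prop := forall i, 0 <= x i <= 1.
Definition X := {x : nat -> R | Xpred x}.

Lemma in01_0 : forall i : nat, 0 <= (fun _ : nat => (0 : R)) i <= 1.
Proof. by move=> i; rewrite /= lexx ler01. Qed.

Definition X0 : X := exist Xpred (fun _ => 0) in01_0.

HB.instance Definition _ := gen_eqMixin X.
HB.instance Definition _ := gen_choiceMixin X.
HB.instance Definition _ := isPointed.Build X X0.

Definition dX (x y : X) : R :=
  limn (fun n => \sum_(0 <= i < n) (`|proj1_sig x i - proj1_sig y i| / 2 ^+ i.+1)).

Definition shift (x : X) : X :=
  exist Xpred (fun i => proj1_sig x i.+1) (fun i => proj2_sig x i.+1).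

Definition openX : set (set X) :=
  [set A | forall x, A x -> exists2 r : R, 0 < r & forall y, dX x y < r -> A y].

Definition XB := g_sigma_algebraType openX.

Definition shift_invariant (mu : probability XB R) : Prop :=
  forall A : set XB, measurable A -> mu (shift @^-1` A) = mu A.

Definition alpha (phi : X -> R) : \bar R :=
  ereal_inf [set (\int[mu]_x (phi x)%:E)%E | mu in [set mu | shift_invariant mu]].

Definition Bset (x y : X) (n : nat) (eps : R) : set X :=
  [set z | dX x z < eps /\ dX (iter n shift z) y < eps].

Definition peierls (phi : X -> R) (x y : X) : \bar R :=
  lim ((fun eps : R => limn_einf (fun n : nat =>
      ereal_inf [set (\sum_(0 <= i < n) ((phi (iter i shift z))%:E - alpha phi))%E
                | z in Bset x y n eps])) @ 0^'+).

Definition phi_of (h : R -> R -> R) (x : X) : R := h (proj1_sig x 0) (proj1_sig x 1).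

Definition constX (a : R) (ha : 0 <= a <= 1) : X := exist Xpred (fun _ => a) (fun _ => ha).

Definition hstar (h : R -> R -> R) : R := inf [set h x x | x in [set x : R | 0 <= x <= 1]].
Definition mh (h : R -> R -> R) : set R := [set a | 0 <= a <= 1 /\ h a a = hstar h].

Definition minimal (h : R -> R -> R) (x : nat -> R) (k l : nat) : Prop :=
  (forall i, (k <= i <= l)%N -> 0 <= x i <= 1) /\
  forall y : nat -> R, (forall i, (k <= i <= l)%N -> 0 <= y i <= 1) ->
    y k = x k -> y l = x l ->
    \sum_(k <= i < l) h (x i) (x i.+1) <= \sum_(k <= i < l) h (y i) (y i.+1).

Definition in01 (t : R) := 0 <= t <= 1.

Definition lipschitz01 (h : R -> R -> R) : Prop :=
  exists L : R, forall x1 y1 x2 y2, in01 x1 -> in01 y1 -> in01 x2 -> in01 y2 ->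
    `|h x1 y1 - h x2 y2| <= L * (`|x1 - x2| + `|y1 - y2|).

Definition H3 (h : R -> R -> R) : Prop :=
  forall xi1 xi2 eta1 eta2, in01 xi1 -> in01 xi2 -> in01 eta1 -> in01 eta2 ->
    xi1 < xi2 -> eta1 < eta2 ->
    h xi1 eta1 + h xi2 eta2 < h xi1 eta2 + h xi2 eta1.

(* triples (x_{-1}, x_0, x_1) are encoded as sequences indexed 0,1,2 *)
Definition triple (u v w : R) : nat -> R :=
  fun i => if i == 0%N then u else if i == 1%N then v else w.

Definition H4 (h : R -> R -> R) : Prop :=
  forall xm x0 x1 xm' x1',
    (xm, x0, x1) <> (xm', x0, x1') ->
    minimal h (triple xm x0 x1) 0 2 -> minimal h (triple xm' x0 x1') 0 2 ->
    (xm - xm') * (x1 - x1') < 0.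

Definition classH (h : R -> R -> R) : Prop := lipschitz01 h /\ H3 h /\ H4 h.

End Defs.

(* Main.v *)
Require Import Defs.
From HB Require Import structures.
From mathcomp Require Import all_boot all_order all_algebra.
From mathcomp Require Import all_classical all_reals all_analysis.
From mathcomp Require Import measurable_realfun ring lra.
Import Order.TTheory GRing.Theory Num.Theory.
Import numFieldNormedType.Exports.
Local Open Scope classical_set_scope.
Local Open Scope ring_scope.
Set Implicit Arguments. Unset Strict Implicit. Unset Printing Implicit Defensive.

(** Write [c x y = h x y - h*].  By (H3), deleting a maximal point [M] from a
    cyclic sequence releases at least [c M M >= 0], so every closed walk has
    non-negative total [c]-cost.  Applied to Birkhoff sums of an invariant
    measure this gives [alpha = h*], attained at the Dirac mass on [a^oo].
    The Peierls barrier from [a^oo] to [b^oo] is then the infimum [K a b] of the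
    costs of finite paths from [a] to [b]: paths can be padded for free by
    staying at [a] or [b], and moving endpoints by [eps] costs [O(eps)].  The
    function [x |-> K a x + K x a] is non-negative, Lipschitz on the component
    of [a], vanishes at [a], and by hypothesis its upper right Dini derivative
    is at most [0]; hence it vanishes at [b]. *)

(** * Costs of paths and cycles, and the minimal path cost *)

Section PathCost.
Variables (R : realType) (h : R -> R -> R).

(** [hstar h] will turn out to be [alpha (phi_of h)], so step costs along an orbit add up to the
    sums in the Peierls barrier. *)
Definition step_cost (x y : R) : R := h x y - hstar h.

(** The starting point is kept apart from the later points, so that joining paths is [++] and [[::]]
    is the path of length zero. *)
Fixpoint path_cost (x : R) (p : seq R) : R :=
  if p is y :: q then step_cost x y + path_cost y q else 0.

Definition cycle_cost (s : seq R) : R :=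
  if s is x :: p then path_cost x (rcons p x) else 0.

Lemma path_cost_cat x p q :
  path_cost x (p ++ q) = path_cost x p + path_cost (last x p) q.
Proof. by elim: p x => [|y p IH] x /=; rewrite ?add0r// IH addrA. Qed.

Lemma path_cost_rcons x p y :
  path_cost x (rcons p y) = path_cost x p + step_cost (last x p) y.
Proof. by rewrite -cats1 path_cost_cat /= addr0. Qed.

Lemma path_cost_nseq x n p : step_cost x x = 0 ->
  path_cost x (nseq n x ++ p) = path_cost x p.
Proof. by move=> x0; elim: n => //= n ->; rewrite x0 add0r. Qed.

Lemma path_cost_nth d x p :
  path_cost x p =
  \sum_(0 <= i < size p) step_cost (nth d (x :: p) i) (nth d (x :: p) i.+1).
Proof.
elim: p x => [|y p IH] x; first by rewrite big_geq.
by rewrite [LHS]/= IH /= big_nat_recl.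
Qed.

Lemma cycle_cost_catC s t : cycle_cost (s ++ t) = cycle_cost (t ++ s).
Proof.
case: s t => [|x s] [|y t]; rewrite ?cats0 ?cat0s //=.
rewrite !rcons_cat /= !path_cost_cat /= !path_cost_rcons; ring.
Qed.

Lemma max_split (s : seq R) : s != [::] ->
  exists s1 M s2, s = s1 ++ M :: s2 /\ all (fun t => t <= M) (s1 ++ s2).
Proof.
elim: s => // x s IH _; case: (eqVneq s [::]) => [->|/IH].
  by exists [::], x, [::].
move=> [s1 [M [s2 [-> aM]]]]; have [xM|/ltW Mx] := leP x M.
  by exists (x :: s1), M, s2; split=> //=; rewrite xM.
exists [::], x, (s1 ++ M :: s2); split => //=.
move: aM; rewrite !all_cat /= Mx => /andP[a1 a2].
by rewrite !(sub_all _ a1, sub_all _ a2) // => t /= /le_trans; apply.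
Qed.

Hypothesis h_lip : lipschitz01 h.
Hypothesis h_H3 : H3 h.

Lemma lipschitz01_ge0 : exists2 L : R, 0 <= L &
  forall x1 y1 x2 y2, in01 x1 -> in01 y1 -> in01 x2 -> in01 y2 ->
    `|h x1 y1 - h x2 y2| <= L * (`|x1 - x2| + `|y1 - y2|).
Proof.
case: h_lip => L hL; exists `|L| => // x1 y1 x2 y2 i1 j1 i2 j2.
apply: (le_trans (hL _ _ _ _ i1 j1 i2 j2)).
by rewrite ler_wpM2r ?addr_ge0// ler_norm.
Qed.

Lemma in01_dist_le1 (x y : R) : in01 x -> in01 y -> `|x - y| <= 1.
Proof. by rewrite /in01 => /andP[? ?] /andP[? ?]; rewrite ler_norml; lra. Qed.

Lemma step_cost_diag_ge0 x : in01 x -> 0 <= step_cost x x.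
Proof.
move=> xI; rewrite subr_ge0 ge_inf//; last by exists x.
(* [ge_inf] needs the diagonal values bounded below: both coordinates move by at most 1, which costs
   at most [L * 2]. *)
have [L L0 hL] := lipschitz01_ge0; exists (h x x - L * 2) => _ [y yI <-].
have := hL x x y y xI xI yI yI; rewrite ler_norml => /andP[_].
have := in01_dist_le1 xI yI; nra.
Qed.

(** For [u, v < M] this is (H3) on the pairs [u < M] and [v < M]; if one of them equals [M], both
    sides coincide. Deleting [M] between [u] and [v] thus saves at least [step_cost M M]. *)
Lemma H3_le u v M : in01 u -> in01 v -> in01 M -> u <= M -> v <= M ->
  h u v + h M M <= h u M + h M v.
Proof.
move=> uI vI MI; rewrite le_eqVlt => /predU1P[->|uM].
  by rewrite addrC lexx.
rewrite le_eqVlt => /predU1P[->//|vM].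
exact/ltW/h_H3.
Qed.

(* Deleting a maximal point of a cycle does not increase its cost, by H3. *)
Lemma cycle_cost_ge0 s : (forall t, t \in s -> in01 t) -> 0 <= cycle_cost s.
Proof.
have [n] := ubnP (size s); elim: n s => // n IH s sn sI.
have [->//|/max_split[s1 [M [s2 [sE aM]]]]] := eqVneq s [::].
have MI : in01 M by apply: sI; rewrite sE mem_cat mem_head orbT.
have sI' t : t \in s2 ++ s1 -> in01 t.
  by move=> tI; apply: sI; move: tI; rewrite sE !mem_cat inE => /orP[]->; rewrite ?orbT.
have aM' : all (fun t => t <= M) (s2 ++ s1) by rewrite all_cat andbC -all_cat.
have sz : (size (s2 ++ s1) < n)%N.
  by move: sn; rewrite sE !size_cat /= addnS ltnS addnC.
(* Rotate the cycle so that [M] comes first; its neighbours are then the two ends of [s2 ++ s1]. *)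
rewrite sE cycle_cost_catC /=.
have := IH _ sz sI'; case: (s2 ++ s1) aM' sI' => [|y q] /=.
  by rewrite addr0 step_cost_diag_ge0.
move=> /andP[yM qM] qI; rewrite !path_cost_rcons.
have lI : last y q \in y :: q by exact: mem_last.
have lM : last y q <= M.
  by move: lI; rewrite inE => /predU1P[->//|/(allP qM)].
have := H3_le (qI _ lI) (qI _ (mem_head _ _)) MI lM yM.
have := step_cost_diag_ge0 MI; rewrite /step_cost; lra.
Qed.

Lemma closed_path_cost_ge0 x p : in01 x -> (forall t, t \in p -> in01 t) ->
  last x p = x -> 0 <= path_cost x p.
Proof.
move=> xI; case/lastP: p => [//|p y] pI; rewrite last_rcons => yx.
rewrite yx in pI *; apply: (@cycle_cost_ge0 (x :: p)) => t.
by rewrite inE => /predU1P[->//|tp]; apply: pI; rewrite mem_rcons inE tp orbT.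
Qed.

Definition paths (x y : R) : set (seq R) :=
  [set p | last x p = y /\ forall t, t \in p -> in01 t].

(** The [K] of the introduction, an analogue of the Mañé potential; paths of every length
    compete. *)
Definition min_cost (x y : R) : R := inf [set path_cost x p | p in paths x y].

Lemma paths_cat x y z p q : paths x y p -> paths y z q -> paths x z (p ++ q).
Proof.
move=> [py pI] [qz qI]; split; first by rewrite last_cat py.
by move=> t; rewrite mem_cat => /orP[/pI|/qI].
Qed.

Lemma paths_seq1 x y : in01 y -> paths x y [:: y].
Proof. by move=> yI; split=> // t; rewrite inE => /eqP ->. Qed.

Lemma has_inf_path_cost x y : in01 x -> in01 y ->
  has_inf [set path_cost x p | p in paths x y].
Proof.
move=> xI yI; split; first by eexists; exists [:: y] => //; exact: paths_seq1.
(* Stepping from [y] back to [x] closes the path, and closed paths have non-negative cost. *)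
exists (- step_cost y x) => _ [p xyp <-].
have [lx pI] := paths_cat xyp (paths_seq1 y xI).
have := closed_path_cost_ge0 xI pI lx; rewrite path_cost_cat /=.
by case: xyp => -> _; lra.
Qed.

Lemma min_cost_le x y p : in01 x -> in01 y -> paths x y p ->
  min_cost x y <= path_cost x p.
Proof.
move=> xI yI xyp; apply: ge_inf; last by exists p.
by case: (has_inf_path_cost xI yI).
Qed.

Lemma min_cost_le_step x y : in01 x -> in01 y -> min_cost x y <= step_cost x y.
Proof.
move=> xI yI; rewrite -[leRHS]addr0.
exact: (min_cost_le xI yI (paths_seq1 x yI)).
Qed.

Lemma min_cost_adherent x y e : in01 x -> in01 y -> 0 < e ->
  exists2 p, paths x y p & path_cost x p < min_cost x y + e.
Proof.
move=> xI yI e0; have [_ [p xyp <-] pe] := inf_adherent e0 (has_inf_path_cost xI yI).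
by exists p.
Qed.

Lemma min_cost_triangle x y z : in01 x -> in01 y -> in01 z ->
  min_cost x z <= min_cost x y + min_cost y z.
Proof.
move=> xI yI zI; apply/ler_addgt0Pr => e e0.
have e20 : 0 < e / 2 by rewrite divr_gt0.
have [p xyp pe] := min_cost_adherent xI yI e20.
have [q yzq qe] := min_cost_adherent yI zI e20.
have := min_cost_le xI zI (paths_cat xyp yzq); rewrite path_cost_cat.
by case: xyp => -> _; lra.
Qed.

(** The empty path gives one inequality, non-negativity of closed paths the other. *)
Lemma min_costxx x : in01 x -> min_cost x x = 0.
Proof.
move=> xI; apply/eqP; rewrite eq_le; apply/andP; split.
  by apply: (min_cost_le xI xI (p := [::])); split.
apply: lb_le_inf; first by case: (has_inf_path_cost xI xI).
by move=> _ [p [lx pI] <-]; exact: closed_path_cost_ge0.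
Qed.

Lemma min_cost_loop_ge0 x y : in01 x -> in01 y ->
  0 <= min_cost x y + min_cost y x.
Proof. by move=> xI yI; rewrite -(min_costxx xI) min_cost_triangle. Qed.

(** Bounds the growth of the loop cost from [y] to [z] by one round trip between them, the quantity
    that the Lipschitz and derivative hypotheses control. *)
Lemma min_cost_loop_le x y z : in01 x -> in01 y -> in01 z ->
  min_cost x z + min_cost z x <=
  min_cost x y + min_cost y x + (step_cost y z + step_cost z y).
Proof.
move=> xI yI zI.
have := min_cost_triangle xI yI zI; have := min_cost_triangle zI yI xI.
have := min_cost_le_step yI zI; have := min_cost_le_step zI yI; lra.
Qed.

End PathCost.

(** * Vanishing of the loop cost by a Dini derivative argument *)

(** For each slope [e > 0], the points where [f] lies below the line of slope [e] through [(a, f a)]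
    have a supremum. By [fC] it is itself such a point, and by [fdini] it cannot lie left of [b]. *)
Lemma dini_le (R : realType) (f : R -> R) (a b C : R) : a <= b ->
  (forall x y, a <= x -> x <= y -> y <= b -> f y <= f x + C * (y - x)) ->
  (forall x e, a <= x -> x < b -> 0 < e ->
     exists d, [/\ 0 < d, x + d <= b & f (x + d) <= f x + e * d]) ->
  f b <= f a.
Proof.
move=> ab fC fdini.
suff H e : 0 < e -> f b <= f a + e * (b - a).
  (* The [+ 1] keeps the denominator positive when [a = b]. *)
  apply/ler_addgt0Pr => e e0; have e' : 0 < e / (b - a + 1) by rewrite divr_gt0//; lra.
  apply: (le_trans (H _ e')); rewrite lerD2l mulrAC ler_pdivrMr; nra.
move=> e0; pose S := [set x | [/\ a <= x, x <= b & f x <= f a + e * (x - a)]].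
have Sa : S a by split => //; rewrite subrr mulr0 addr0.
have Sb : ubound S b by move=> x [].
have supS : has_sup S by split; [exists a | exists b].
have aS : a <= sup S by apply: ub_le_sup => //; exists b.
have Sle : sup S <= b by apply: ge_sup => //; exists a.
have SS : f (sup S) <= f a + e * (sup S - a).
  apply/ler_addgt0Pr => r r0.
  have C0 : 0 < `|C| + 1 by rewrite ltr_wpDl.
  (* A point of [S] this close to [sup S] lets [f] grow by less than [r] on the way to [sup S]. *)
  have r' : 0 < r / (`|C| + 1) by rewrite divr_gt0.
  have [x [ax xb fx]] := sup_adherent r' supS.
  have xS : x <= sup S by apply: ub_le_sup; [exists b | split].
  rewrite ltrBlDr -ltrBlDl ltr_pdivlMr// => xr.
  have := fC _ _ ax xS Sle; have := ler_norm C.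
  move: fx xr xS e0; move: (`|C|) => c; nra.
suff <- : sup S = b by [].
apply/eqP; rewrite eq_le Sle /= leNgt; apply/negP => sb.
have [d [d0 db fd]] := fdini _ _ aS sb e0.
have : S (sup S + d) by split=> //; [lra | nra].
move=> /(ub_le_sup (proj2 supS)); lra.
Qed.

Lemma min_cost_loop_eq0 (R : realType) (h : R -> R -> R) (a b : R) :
  lipschitz01 h -> H3 h -> a <= b ->
  (forall z, a <= z <= b -> mh h z) ->
  (forall z, a <= z <= b ->
     (fun d : R => (h (z + d) z - h z z) / d + (h z (z + d) - h z z) / d)
       @ 0^'+ --> (0 : R)) ->
  min_cost h a b + min_cost h b a = 0.
Proof.
move=> hL h3 ab abm hd.
have I z : a <= z <= b -> in01 z by move=> /abm[].
have aI : in01 a by apply: I; rewrite lexx.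
have bI : in01 b by apply: I; rewrite lexx ab.
apply/eqP; rewrite eq_le min_cost_loop_ge0// andbT.
have -> : 0 = min_cost h a a + min_cost h a a by rewrite min_costxx// addr0.
have [L L0 Lip] := lipschitz01_ge0 hL.
(* Each of the two steps between [x] and [y] costs at most [L * (y - x)], since
   [step_cost h x x = 0]; hence [2 * L]. *)
apply: (@dini_le _ (fun x => min_cost h a x + min_cost h x a) _ _ (2 * L)) => //.
  move=> x y ax xy yb.
  have xab : a <= x <= b by lra.
  have xI := I _ xab; have yI : in01 y by apply: I; lra.
  apply: (le_trans (min_cost_loop_le hL h3 aI xI yI)); rewrite lerD2l.
  rewrite /step_cost; have [_ <-] := abm _ xab.
  have := Lip x y x x xI yI xI xI; have := Lip y x x x yI xI xI xI.
  rewrite !subrr normr0 addr0 add0r (ger0_norm (x := y - x)) ?subr_ge0//.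
  rewrite !ler_norml.
  by move=> /andP[_ ?] /andP[_ ?]; lra.
move=> x e ax xb e0; have xab : a <= x <= b by lra.
have [_ hx] := abm _ xab.
have /cvgrPdist_lt/(_ _ e0) H := hd _ xab.
have bx : 0 < b - x by rewrite subr_gt0.
(* For small [d] the sum of quotients is below [e]; as [h x x = hstar h], multiplying by [d] bounds
   the round trip between [x] and [x + d]. *)
near (0 : R)^'+ => d.
have d0 : 0 < d by near: d; exact: nbhs_right_gt.
have db : d < b - x by near: d; exact: nbhs_right_lt.
exists d; split=> //; first by lra.
have xdI : in01 (x + d) by apply: I; lra.
apply: (le_trans (min_cost_loop_le hL h3 aI (I _ xab) xdI)); rewrite lerD2l.
have : `|0 - ((h (x + d) x - h x x) / d + (h x (x + d) - h x x) / d)| < e.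
  by near: d.
rewrite sub0r normrN -mulrDl => /ltr_normlW; rewrite ltr_pdivrMr//.
by rewrite /step_cost -hx; lra.
Unshelve. all: by end_near.
Qed.

(** * Metric estimates on the sequence space *)

Section ShiftSpace.
Variable R : realType.
Implicit Types x y z : X R.

Lemma proj_in01 x i : in01 (proj1_sig x i).
Proof. exact: (proj2_sig x i). Qed.

Lemma iter_shiftE n x k : proj1_sig (iter n (@Defs.shift R) x) k = proj1_sig x (n + k)%N.
Proof. by elim: n k => //= n IH k; rewrite IH addnS. Qed.

(** Monotone and bounded, as shown below, so the [limn] in [dX] is a true limit and not a default
    value. *)
Let partial_dX x y n : R :=
  \sum_(0 <= i < n) (`|proj1_sig x i - proj1_sig y i| / 2 ^+ i.+1).

Lemma sum_geometric_half m n : (m <= n)%N ->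
  \sum_(m <= i < n) (2 ^+ i.+1)^-1 = (2 ^+ m)^-1 - (2 ^+ n)^-1 :> R.
Proof.
move=> mn; have -> : (2 ^+ m)^-1 - (2 ^+ n)^-1 = - (2 ^+ n)^-1 - - (2 ^+ m)^-1 :> R.
  by ring.
rewrite -(telescope_sumr (fun i => - (2 ^+ i)^-1))//.
apply: eq_bigr => i _; rewrite exprS.
have : (2 : R) ^+ i != 0 by rewrite expf_neq0.
by move=> ?; field.
Qed.

Lemma dX_term_ge0 x y i : 0 <= `|proj1_sig x i - proj1_sig y i| / 2 ^+ i.+1.
Proof. by rewrite divr_ge0// exprn_ge0. Qed.

Let partial_dX_nd x y : nondecreasing_seq (partial_dX x y).
Proof.
apply/nondecreasing_seqP => n.
by rewrite /partial_dX big_nat_recr//= lerDl dX_term_ge0.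
Qed.

Let partial_dX_le x y N n : (forall i, (i < N)%N -> proj1_sig x i = proj1_sig y i) ->
  partial_dX x y n <= (2 ^+ N)^-1.
Proof.
(* Summing up to [maxn N n] allows a split at [N]: the head vanishes and a geometric tail dominates
   the rest. *)
move=> xyN; apply: (@le_trans _ _ (partial_dX x y (maxn N n))).
  by apply: partial_dX_nd; rewrite leq_maxr.
rewrite /partial_dX (big_cat_nat (n := N)) ?leq_maxl//= big_nat big1 ?add0r; last first.
  by move=> i /andP[_ iN]; rewrite xyN// subrr normr0 mul0r.
apply: (@le_trans _ _ (\sum_(N <= i < maxn N n) (2 ^+ i.+1)^-1)).
  apply: ler_sum => i _; rewrite ler_piMl ?invr_ge0 ?exprn_ge0//.
  exact/in01_dist_le1/proj_in01/proj_in01.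
by rewrite sum_geometric_half ?leq_maxl// gerBl invr_ge0 exprn_ge0.
Qed.

Let partial_dX_cvg x y : cvgn (partial_dX x y).
Proof.
apply: nondecreasing_is_cvgn; first exact: partial_dX_nd.
by exists (2 ^+ 0)^-1 => _ [n _ <-]; exact: partial_dX_le.
Qed.

Let partial_dX_le_dX x y n : partial_dX x y n <= dX x y.
Proof. exact: nondecreasing_cvgn_le (@partial_dX_nd _ _) (@partial_dX_cvg _ _) _. Qed.

Lemma dX_le_expn x y N : (forall i, (i < N)%N -> proj1_sig x i = proj1_sig y i) ->
  dX x y <= (2 ^+ N)^-1.
Proof.
move=> xyN; apply: limr_le; first exact: partial_dX_cvg.
by near=> n; exact: partial_dX_le.
Unshelve. all: by end_near.
Qed.

(** A single term of the series is at most its sum. *)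
Lemma dist_proj_le x y i :
  `|proj1_sig x i - proj1_sig y i| <= 2 ^+ i.+1 * dX x y.
Proof.
rewrite mulrC -ler_pdivrMr ?exprn_gt0//.
apply: le_trans (partial_dX_le_dX x y i.+1).
by rewrite /partial_dX big_nat_recr//= lerDr sumr_ge0// => j _; exact: dX_term_ge0.
Qed.

Lemma dX_shift_le x y : dX (Defs.shift x) (Defs.shift y) <= 2 * dX x y.
Proof.
apply: limr_le; first exact: partial_dX_cvg.
near=> n; have := partial_dX_le_dX x y n.+1.
rewrite /partial_dX big_nat_recl//= => H.
apply: (@le_trans _ _ (2 * \sum_(0 <= i < n)
    (`|proj1_sig x i.+1 - proj1_sig y i.+1| / 2 ^+ i.+2))).
  rewrite mulr_sumr; apply: ler_sum => i _; rewrite [2 ^+ i.+2]exprS.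
  have : (2 : R) ^+ i.+1 != 0 by rewrite expf_neq0.
  by move: (2 ^+ i.+1) => c c0; rewrite le_eqVlt; apply/orP; left; apply/eqP; field.
by rewrite ler_pM2l//; apply: le_trans H; rewrite lerDr dX_term_ge0.
Unshelve. all: by end_near.
Qed.

End ShiftSpace.

(** * Invariant measures and the value of [alpha] *)

Section MinimizingMeasure.
Variable R : realType.

Lemma lipschitz_measurable_XB (f : XB R -> R) (C : R) : 0 <= C ->
  (forall x y, `|f x - f y| <= C * dX x y) -> measurable_fun setT f.
Proof.
move=> C0 fC; apply: (measurability _ (RGenOInfty.measurableE R)) => //.
move=> _ [_ [u ->] <-]; rewrite setTI; apply: sub_sigma_algebra => x /=.
rewrite in_itv /= andbT => ux.
have C1 : 0 < C + 1 by rewrite ltr_wpDl.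
(* Within this radius [f] drops by less than [f x - u], so preimages of open rays are open; the
   [+ 1] covers [C = 0]. *)
exists ((f x - u) / (C + 1)); first by rewrite divr_gt0// subr_gt0.
move=> y; rewrite ltr_pdivlMr// in_itv /= andbT => xy.
have := fC x y; rewrite ler_norml => /andP[_ fxy].
have d0 : 0 <= dX x y.
  by have := le_trans (normr_ge0 _) (dist_proj_le x y 0); rewrite expr1 pmulr_rge0.
nra.
Qed.

Lemma shift_measurable : measurable_fun setT (@Defs.shift R : XB R -> XB R).
Proof.
apply: (@measurability _ _ (XB R) (XB R) setT _ (@openX R) erefl).
move=> _ [A oA <-]; rewrite setTI.
apply: sub_sigma_algebra => x /oA[r r0 rA]; exists (r / 2); first by rewrite divr_gt0.
move=> y xy; apply: rA; apply: le_lt_trans (dX_shift_le x y) _; lra.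
Qed.

Lemma iter_shift_measurable n :
  measurable_fun setT (iter n (@Defs.shift R) : XB R -> XB R).
Proof.
elim: n => [|n IH]; first exact: measurable_id.
exact: (measurableT_comp shift_measurable IH).
Qed.

Lemma integral_iter_shift (mu : probability (XB R) R) (f : XB R -> R) n :
  shift_invariant mu -> measurable_fun setT f -> [bounded f x | x in setT] ->
  (\int[mu]_x (f (iter n (@Defs.shift R) x))%:E = \int[mu]_x (f x)%:E)%E.
Proof.
move=> inv; elim: n f => // n IH f mf bf.
have mfs : measurable_fun setT (f \o @Defs.shift R : XB R -> R).
  exact: (measurableT_comp mf shift_measurable).
have bfs : [bounded (f \o @Defs.shift R) x | x in [set: XB R]].
  by case: bf => M [Mr fM]; exists M; split=> // N MN x _; exact: (fM N MN).
have -> : (\int[mu]_x (f (iter n.+1 (@Defs.shift R) x))%:E =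
           \int[mu]_x ((f \o @Defs.shift R) x)%:E)%E by rewrite -(IH _ mfs bfs).
have := @integral_pushforward _ _ (XB R) (XB R) R (@Defs.shift R) shift_measurable mu
  setT (EFin \o f).
rewrite preimage_setT => <- //; last 2 first.
- exact/measurable_EFinP.
- apply: measurable_bounded_integrable => //.
  by apply: (le_lt_trans (probability_le1 mu measurableT)); rewrite ltry.
(* Invariance says that the pushforward of [mu] by the shift agrees with [mu]. *)
unshelve eapply (@eq_measure_integral _ (XB R) R setT mu); first exact: shift_measurable.
by move=> A mA _; exact: inv.
Qed.

Variable h : R -> R -> R.
Hypotheses (h_lip : lipschitz01 h) (h_H3 : H3 h).
Variable (a : R).
Hypothesis a_mh : mh h a.

Lemma birkhoff_sumE (z : X R) n :
  \sum_(0 <= i < n) (phi_of h (iter i (@Defs.shift R) z) - hstar h) =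
  \sum_(0 <= i < n) step_cost h (proj1_sig z i) (proj1_sig z i.+1).
Proof. by apply: eq_bigr => i _; rewrite /phi_of !iter_shiftE addn0 addn1. Qed.

Lemma path_cost_orbit (z : X R) n :
  path_cost h (proj1_sig z 0) (mkseq (fun i => proj1_sig z i.+1) n) =
  \sum_(0 <= i < n) step_cost h (proj1_sig z i) (proj1_sig z i.+1).
Proof.
rewrite (path_cost_nth h (proj1_sig z n)) size_mkseq.
rewrite !big_nat; apply: eq_bigr => i /andP[_ ilt] /=; rewrite nth_mkseq//.
by case: i ilt => //= i /ltnW ilt; rewrite nth_mkseq.
Qed.

Lemma paths_orbit (z : X R) n :
  paths (proj1_sig z 0) (proj1_sig z n) (mkseq (fun i => proj1_sig z i.+1) n).
Proof.
split; last by move=> t /mapP[i _ ->]; exact: proj_in01.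
by case: n => // n; rewrite /mkseq -addn1 iotaD map_cat last_cat /= add0n addn1.
Qed.

Lemma step_cost_bounded : exists2 C, 0 <= C &
  forall x y, in01 x -> in01 y -> `|step_cost h x y| <= C.
Proof.
have [L L0 Lip] := lipschitz01_ge0 h_lip; have [aI ha] := a_mh.
exists (L * 2) => [|x y xI yI]; first by rewrite mulr_ge0.
rewrite /step_cost -ha; apply: (le_trans (Lip _ _ _ _ xI yI aI aI)).
by rewrite ler_wpM2l// [leRHS]mulr2n lerD// in01_dist_le1.
Qed.

(** A step from [z n] back to [z 0] closes the orbit segment into a path of non-negative cost; that
    step costs at most [C], uniformly in [z] and [n]. *)
Lemma birkhoff_sum_ge : exists2 C, 0 <= C & forall (z : X R) n,
  n%:R * hstar h - C <= \sum_(0 <= i < n) phi_of h (iter i (@Defs.shift R) z).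
Proof.
have [C C0 hC] := step_cost_bounded; exists C => // z n.
have [zI zE] := (proj_in01 z, birkhoff_sumE z n).
have [lz pI] := paths_cat (paths_orbit z n) (paths_seq1 (proj1_sig z n) (zI 0%N)).
have := closed_path_cost_ge0 h_lip h_H3 (zI 0%N) pI lz.
rewrite path_cost_cat path_cost_orbit /= addr0 -zE.
case: (paths_orbit z n) => -> _.
have := hC _ _ (zI n) (zI 0%N); rewrite ler_norml => /andP[_].
rewrite sumrB sumr_const_nat subn0 -mulr_natl; lra.
Qed.

Lemma phi_of_measurable : measurable_fun setT (phi_of h : XB R -> R).
Proof.
have [L L0 Lip] := lipschitz01_ge0 h_lip.
(* [6 = 2 + 4], the factors of [dist_proj_le] at coordinates 0 and 1. *)
apply: (@lipschitz_measurable_XB _ (L * 6)); first by rewrite mulr_ge0.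
move=> x y; apply: (le_trans (Lip _ _ _ _ _ _ _ _)); rewrite ?proj_in01//.
rewrite -mulrA ler_wpM2l//.
have := dist_proj_le x y 0; have := dist_proj_le x y 1; rewrite expr1 expr2; lra.
Qed.

Lemma phi_of_bounded : [bounded phi_of h x | x in [set: XB R]].
Proof.
have [C C0 hC] := step_cost_bounded; exists (C + `|hstar h|).
split; first exact: num_real.
move=> M CM x _; apply: le_trans (ltW CM) => /=.
have -> : phi_of h x = step_cost h (proj1_sig x 0) (proj1_sig x 1) + hstar h.
  by rewrite subrK.
by apply: (le_trans (ler_normD _ _)); rewrite lerD2r hC//; exact: proj_in01.
Qed.

(** Integrating [birkhoff_sum_ge] gives [n * hstar h - C <= n * J] for all [n], which fails for
    large [n] if [J < hstar h]. *)
Lemma integral_phi_of_ge (mu : probability (XB R) R) :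
  shift_invariant mu -> ((hstar h)%:E <= \int[mu]_x (phi_of h x)%:E)%E.
Proof.
move=> inv.
have muT : (mu setT < +oo)%E.
  by apply: (le_lt_trans (probability_le1 mu measurableT)); rewrite ltry.
have int_i i : mu.-integrable setT (fun x => (phi_of h (iter i (@Defs.shift R) x))%:E).
  apply: (@measurable_bounded_integrable _ (XB R) R mu
    (phi_of h \o iter i (@Defs.shift R)) setT measurableT) => //.
    exact: (measurableT_comp phi_of_measurable (iter_shift_measurable i)).
  by case: phi_of_bounded => M [Mr fM]; exists M; split=> // N MN x _; exact: (fM N MN).
have Ifin := integrable_fin_num measurableT (int_i 0%N); rewrite /= in Ifin.
have [C C0 hC] := birkhoff_sum_ge.
rewrite -(fineK Ifin) lee_fin; set J := fine _.
have key n : n%:R * hstar h - C <= n%:R * J.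
  rewrite -lee_fin.
  have -> : (n%:R * hstar h - C)%:E = (\int[mu]_x (n%:R * hstar h - C)%:E)%E.
    rewrite integral_cst// -[LHS]mule1; congr (_ * _)%E.
    exact/esym/(probability_setT mu).
  have -> : (n%:R * J)%:E = (\int[mu]_x (\sum_(0 <= i < n)
              (phi_of h (iter i (@Defs.shift R) x))%:E))%E.
    rewrite integral_sum//.
    under eq_bigr do
      rewrite (integral_iter_shift _ inv phi_of_measurable phi_of_bounded) -(fineK Ifin).
    by rewrite sumEFin sumr_const_nat subn0 mulr_natl.
  apply: le_integral => //.
  - exact: finite_measure_integrable_cst.
  - exact: integrable_sum.
  - by move=> x _; rewrite sumEFin lee_fin; exact: hC.
rewrite leNgt; apply/negP => Jh.
have := truncnS_gt (C / (hstar h - J)); set n := (Num.truncn _).+1.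
rewrite ltr_pdivrMr ?subr_gt0// mulrBr; have := key n; lra.
Qed.

(** The infimum is attained at the Dirac mass at [constX aI], which is invariant because the shift
    fixes that point. *)
Lemma alpha_phi_of : alpha (phi_of h) = (hstar h)%:E.
Proof.
apply/eqP; rewrite eq_le; apply/andP; split; last first.
  by apply: le_ereal_inf_tmp => _ [mu inv <-]; exact: integral_phi_of_ge.
have [aI ha] := a_mh.
apply: ereal_inf_lbound; exists (\d_(constX aI : XB R)) => /=; last first.
  rewrite integral_dirac//; last first.
    exact: (proj2 (measurable_EFinP _ _) phi_of_measurable).
  by rewrite diracT mul1e /phi_of /= ha.
by move=> A _; rewrite /= !diracE; congr (_ %:R%:E); rewrite !inE.
Qed.

End MinimizingMeasure.

(** * Lower limits, and the Peierls barrier as minimal path cost *)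

Lemma limn_einf_le (R : realType) (u : nat -> \bar R) (l : \bar R) :
  (\forall n \near \oo, u n <= l)%E -> (limn_einf u <= l)%E.
Proof.
move=> [N _ uN]; rewrite limn_einf_lim; apply: lime_le; first exact: is_cvg_einfs.
near=> n; apply: (@le_trans _ _ (u (maxn n N))).
  by apply: ereal_inf_lbound; exists (maxn n N) => //=; rewrite leq_maxl.
by apply: uN; rewrite /= leq_maxr.
Unshelve. all: by end_near.
Qed.

Lemma limn_einf_ge (R : realType) (u : nat -> \bar R) (l : \bar R) :
  (forall n, l <= u n)%E -> (l <= limn_einf u)%E.
Proof.
move=> lu; rewrite limn_einf_lim; apply: lime_ge; first exact: is_cvg_einfs.
by near=> n; apply: le_ereal_inf_tmp => _ [m _ <-].
Unshelve. all: by end_near.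
Qed.

Section PeierlsBarrier.
Variables (R : realType) (h : R -> R -> R).
Hypotheses (h_lip : lipschitz01 h) (h_H3 : H3 h).
Variables (a b : R) (aI : 0 <= a <= 1) (bI : 0 <= b <= 1).
Hypotheses (a_mh : mh h a) (b_mh : mh h b).

(** The inner infimum of [peierls], before the lower limit in [n] and the limit in [eps]. *)
Let barrier (eps : R) (n : nat) : \bar R :=
  ereal_inf [set (\sum_(0 <= i < n)
      ((phi_of h (iter i (@Defs.shift R) z))%:E - alpha (phi_of h)))%E
    | z in Bset (constX aI) (constX bI) n eps].

Let barrierE (z : X R) n :
  (\sum_(0 <= i < n)
      ((phi_of h (iter i (@Defs.shift R) z))%:E - alpha (phi_of h)))%E =
  (\sum_(0 <= i < n) step_cost h (proj1_sig z i) (proj1_sig z i.+1))%:E.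
Proof. by rewrite (alpha_phi_of h_lip h_H3 a_mh) -birkhoff_sumE -sumEFin. Qed.

(* Joining [a] to [z 0] and [z n] to [b] costs at most [4 L eps]. *)
Let barrier_ge : exists L, forall eps n,
  ((min_cost h a b - L * eps)%:E <= barrier eps n)%E.
Proof.
have [L L0 Lip] := lipschitz01_ge0 h_lip; exists (4 * L) => eps n.
apply: le_ereal_inf_tmp => _ [z [az zb] <-]; rewrite barrierE lee_fin.
have zI := proj_in01 z.
have := min_cost_le h_lip h_H3 aI bI (paths_cat (paths_seq1 a (zI 0%N))
  (paths_cat (paths_orbit z n) (paths_seq1 (proj1_sig z n) bI))).
rewrite !path_cost_cat path_cost_orbit /=.
case: (paths_orbit z n) => -> _; rewrite !addr0.
have [_ ha] := a_mh; have [_ hb] := b_mh.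
(* Coordinate 0 is off by less than [2 * eps] at either end, and the diagonal steps at [a] and [b]
   are free, so each joining step costs at most [2 * L * eps]. *)
have daz := dist_proj_le (constX aI) z 0.
have dzb := dist_proj_le (iter n (@Defs.shift R) z) (constX bI) 0.
rewrite /= iter_shiftE addn0 expr1 in daz dzb.
have : step_cost h a (proj1_sig z 0) <= 2 * L * eps.
  have := Lip _ _ _ _ aI (zI 0%N) aI aI; rewrite ha => /ler_normlW.
  rewrite subrr normr0 add0r distrC /step_cost => /le_trans; apply.
  by rewrite (mulrC 2) -mulrA ler_wpM2l//; lra.
have : step_cost h (proj1_sig z n) b <= 2 * L * eps.
  have := Lip _ _ _ _ (zI n) bI bI bI; rewrite hb => /ler_normlW.
  rewrite subrr normr0 addr0 /step_cost => /le_trans; apply.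
  by rewrite (mulrC 2) -mulrA ler_wpM2l//; lra.
lra.
Qed.

(* A path from [a] to [b] is padded with [a]'s on the left and [b]'s on the right. *)
Let barrier_le eps p : 0 < eps -> paths a b p ->
  (\forall n \near \oo, barrier eps n <= (path_cost h a p)%:E)%E.
Proof.
move=> eps0 [lp pI].
have [N0 _ HN] : \forall N \near \oo, (2 ^+ N)^-1 < eps.
  have : (fun N => (2^-1 : R) ^+ N) @ \oo --> (0 : R).
    by apply: cvg_expr; rewrite ger0_norm ?invr_ge0// invf_lt1// ltr1n.
  move=> /cvgrPdist_lt/(_ _ eps0); apply: filterS => N.
  by rewrite sub0r normrN exprVn ger0_norm// invr_ge0 exprn_ge0.
(* Beyond this threshold there is room for at least [N0] copies of [a] before [p]. *)
exists (N0 + size p)%N => //= n; rewrite /= => Nn.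
pose N := (n - size p)%N.
have pn : (size p <= n)%N by apply: leq_trans Nn; rewrite leq_addl.
pose s := nseq N a ++ p.
have ssz : size s = n by rewrite size_cat size_nseq subnK.
(* The default value [b] of [nth] supplies the infinite tail of [b]'s. *)
have sI i : in01 (nth b (a :: s) i).
  have [|?] := ltnP i (size (a :: s)); last by rewrite nth_default.
  move=> /(mem_nth b); rewrite inE mem_cat => /predU1P[->//|/orP[|/pI//]].
  by move=> /nseqP[->].
pose z : X R := exist (@Xpred R) _ sI.
(* [a :: s] has [n + 1] entries, so index [n] is its last one, the endpoint [b] of [p]; thus the
   [n]-th shift of [z] is the constant sequence [b]. *)
have zn k : nth b (a :: s) (n + k) = b.
  case: k => [|k]; last by rewrite nth_default//= ssz addnS leq_addr.
  have last_nseq m : last a (nseq m a) = a by elim: m => //= -[].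
  by rewrite addn0 -ssz nth_last /= last_cat last_nseq.
apply: ge_ereal_inf; exists (path_cost h a p)%:E => //.
exists z; last first.
  have [_ ha] := a_mh.
  rewrite barrierE -(@path_cost_nseq _ h a N p) ?/step_cost ?ha ?subrr//.
  by rewrite -/s (path_cost_nth h b) ssz.
split.
  apply: le_lt_trans (HN N _); last by rewrite /= leq_subRL// addnC.
  apply: dX_le_expn => i iN /=; case: i iN => //= i iN.
  by rewrite nth_cat size_nseq (ltnW iN) nth_nseq (ltnW iN).
apply: le_lt_trans (HN N _); last by rewrite /= leq_subRL// addnC.
by apply: dX_le_expn => i _; rewrite iter_shiftE /= zn.
Qed.

Lemma peierls_phi_of :
  peierls (phi_of h) (constX aI) (constX bI) = (min_cost h a b)%:E.
Proof.
have [L bar_ge] := barrier_ge.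
apply: cvg_lim => //.
(* For each [eps > 0] the lower limit lies between [min_cost h a b - L * eps] and
   [min_cost h a b]. *)
apply: (@squeeze_cvge _ _ _ _ (fun eps => (min_cost h a b - L * eps)%:E) _
  (fun=> (min_cost h a b)%:E)); last 2 first.
- apply: cvg_EFin; first by near=> eps.
  rewrite -[X in _ --> X]subr0; apply: cvgB; first exact: cvg_cst.
  rewrite -[X in _ --> X](mulr0 L); apply: cvgM; first exact: cvg_cst.
  by apply: cvg_at_right_filter; exact: cvg_id.
- exact: cvg_cst.
near=> eps; apply/andP; split; first by apply: limn_einf_ge => n; exact: bar_ge.
have eps0 : 0 < eps by near: eps; exact: nbhs_right_gt.
apply/lee_addgt0Pr => r r0.
(* One path within [r] of the infimum, suitably padded, bounds the barrier for all large [n]. *)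
have [p abp /ltW pr] := min_cost_adherent h_lip h_H3 aI bI r0.
apply: limn_einf_le; apply: filterS (barrier_le eps0 abp) => n /le_trans; apply.
by rewrite -EFinD lee_fin.
Unshelve. all: by end_near.
Qed.

End PeierlsBarrier.

Theorem theorem4p5 (R : realType) (h : R -> R -> R) (a b : R)
    (ha : 0 <= a <= 1) (hb : 0 <= b <= 1) :
  classH h ->
  mh h a -> mh h b ->
  connected_component (mh h) a b ->
  (forall z, connected_component (mh h) a z ->
     (fun d : R => (h (z + d) z - h z z) / d + (h z (z + d) - h z z) / d)
       @ 0^'+ --> (0 : R)) ->
  (peierls (phi_of h) (constX ha) (constX hb)
   + peierls (phi_of h) (constX hb) (constX ha))%E = 0%E.
Proof.
move=> [h_lip [h_H3 _]] a_mh b_mh Cab hd.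
rewrite !peierls_phi_of// -EFinD; congr EFin.
have Caa := connected_component_refl a_mh.
(* Connected subsets of the line are intervals, so every point between [a] and [b] is in the
   component and satisfies the derivative hypothesis. *)
have Citv : is_interval (connected_component (mh h) a).
  exact/connected_intervalP/component_connected.
have [ab|/ltW ba] := leP a b.
  have C z : a <= z <= b -> connected_component (mh h) a z by exact: Citv.
  apply: min_cost_loop_eq0 => // z /C Cz; first exact: connected_component_sub Cz.
  exact: hd.
have C z : b <= z <= a -> connected_component (mh h) a z by exact: Citv.
(* The sum is symmetric in [a] and [b], so the Dini argument may start from [b], the smaller
   point. *)
rewrite addrC; apply: min_cost_loop_eq0 => // z /C Cz.
  exact: connected_component_sub Cz.
exact: hd.
Qed.
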